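(* Let $m\in\frac12\mathbf{Z}_{\ge0}$, and let $a$ be the largest natural number such that $2^a<2m+1$. Then $Q_m(3,\mathbf{F}_2)_{\mathrm{std}}$ is freely generated by $$(x_1-x_2)^{2^{a+1}}\qquad\text{and}\qquad (x_1-x_2)^{2^a}\prod_{1\le i<j\le 3}(x_i-x_j)^{2m+1-2^a}.$$
   Context: $S_3$ acts on $\mathbf{F}_2[x_1,x_2,x_3]$ by permuting variables, $s_{ij}$ is the transposition of $x_i,x_j$, and $R=\mathbf{F}_2[x_1,x_2,x_3]^{S_3}$. Natural numbers include $0$. For $m\in\frac12\mathbf{Z}_{\ge0}$, $Q_m(3,\mathbf{F}_2)$ is the $R$-module of all $K\in\mathbf{F}_2[x_1,x_2,x_3]$ such that $(x_i-x_j)^{2m+1}$ divides $(1-s_{ij})K$ for all $1\le i<j\le3$. Let $\mathrm{std}$ be the $2$-dimensional irreducible representation of $S_3$ over $\mathbf{F}_2$ (the reduction mod $2$ of the standard representation). $Q_m(3,\mathbf{F}_2)_{\mathrm{std}}$ is the sum of all subrepresentations of $Q_m(3,\mathbf{F}_2)$ isomorphic to $\mathrm{std}$. ''Freely generated by $f$ and $g$'' for $Q_m(3,\mathbf{F}_2)_{\mathrm{std}}$ means: the $S_3$-subrepresentations $V,W$ generated by $f$ and $g$ are copies of $\mathrm{std}$, and the multiplication map $R\otimes_{\mathbf{F}_2}(V\oplus W)\to Q_m(3,\mathbf{F}_2)_{\mathrm{std}}$ is an isomorphism (so $Q_m(3,\mathbf{F}_2)_{\mathrm{std}}$ is a free $R$-module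 of rank $4$). *)

(* Defs.v *)
From HB Require Import structures.
From mathcomp Require Import all_boot all_order all_fingroup all_algebra.
From mathcomp Require Import mxrepresentation.
From mathcomp Require Import mpoly.

Set Implicit Arguments.
Unset Strict Implicit.
Unset Printing Implicit Defensive.

Import GRing.Theory.
Local Open Scope ring_scope.

Notation poly3 := {mpoly 'F_2[3]}.

(* The action of S_3 on poly3 is msym: msym s maps 'X_i to 'X_(s i).          *)
(* Permutations compose left to right, so msym is a right action, like the    *)
(* action of a matrix representation on row vectors.                          *)

(* The ring R of invariants, with its F_2-vector space structure. *)
Record sympoly3 :=
  SymPoly3 { poly_of_sym :> poly3; _ : poly_of_sym \is symmetric }.
HB.instance Definition _ := [isSub for poly_of_sym].
HB.instance Definition _ := [Choice of sympoly3 by <:].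
HB.instance Definition _ := [SubChoice_isSubLmodule of sympoly3 by <:].

(* The standard representation mod 2: vectors of coordinate sum zero in the   *)
(* permutation representation F_2^3, where s maps e_i to e_(s i).             *)

Lemma perm3_repr : mx_repr [set: 'S_3] (fun s : 'S_3 => perm_mx s : 'M['F_2]_3).
Proof. by split=> [|s t _ _]; rewrite ?perm_mx1 ?perm_mxM. Qed.

Definition perm3 : mx_representation 'F_2 [set: 'S_3]%G 3 :=
  MxRepresentation perm3_repr.

Definition sum0_mx : 'M['F_2]_3 := kermx (const_mx 1 : 'cV_3).

Lemma sum0_module : mxmodule perm3 sum0_mx.
Proof.
apply/mxmoduleP=> s _; apply/sub_kermxP; rewrite /= -mulmxA.
suff ->: perm_mx s *m const_mx 1 = const_mx 1 :> 'cV['F_2]_3.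
  exact: mulmx_ker.
by rewrite -row_permE; apply/matrixP=> i j; rewrite !mxE.
Qed.

Definition std : mx_representation 'F_2 [set: 'S_3]%G (\rank sum0_mx) :=
  submod_repr sum0_module.

Definition subrep (V : {pred poly3}) : Prop :=
  submod_closed V /\ forall (s : 'S_3) p, p \in V -> msym s p \in V.

Definition iso_std (V : {pred poly3}) : Prop :=
  exists phi : {linear 'rV['F_2]_(\rank sum0_mx) -> poly3},
    [/\ injective phi,
        forall (s : 'S_3) v, phi (v *m std s) = msym s (phi v) &
        forall p, p \in V <-> exists v, phi v = p].

(* The natural number 2m+1, for m a nonnegative half-integer. *)
Definition qexp (m : rat) : nat := Num.truncn (2 * m + 1).

Definition mpoly_dvd (d p : poly3) : Prop := exists q, p = q * d.

Definition Q (m : rat) (K : poly3) : Prop :=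
  forall i j : 'I_3, (i < j)%N ->
    mpoly_dvd (('X_i - 'X_j) ^+ qexp m) (K - msym (tperm i j) K).

Definition Qstd (m : rat) (p : poly3) : Prop :=
  exists ps : seq poly3,
    p = \sum_(q <- ps) q /\
    forall q, q \in ps -> exists V : {pred poly3},
      [/\ subrep V, forall r, r \in V -> Q m r, iso_std V & q \in V].

(* The subrepresentation generated by f, i.e. F_2[S_3] f. *)

Definition in_genrep (f : poly3) : pred poly3 :=
  fun p => [exists c : {ffun 'S_3 -> 'F_2}, p == \sum_s c s *: msym s f].

Lemma in_genrep_submod f : submod_closed (in_genrep f).
Proof.
split=> [|a p q].
  apply/existsP; exists [ffun => 0]; apply/eqP.
  by rewrite big1 // => s _; rewrite ffunE scale0r.
move=> /existsP[c /eqP->] /existsP[d /eqP->].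
apply/existsP; exists [ffun s => a * c s + d s]; apply/eqP.
rewrite scaler_sumr -big_split /=; apply: eq_bigr => s _.
by rewrite ffunE scalerDl scalerA.
Qed.

HB.instance Definition _ f :=
  GRing.isSubmodClosed.Build 'F_2 poly3 (in_genrep f) (in_genrep_submod f).

Record genrep (f : poly3) :=
  GenRep { poly_of_genrep :> poly3; _ : in_genrep f poly_of_genrep }.
HB.instance Definition _ f := [isSub for @poly_of_genrep f].
HB.instance Definition _ f := [Choice of genrep f by <:].
HB.instance Definition _ f := [SubChoice_isSubLmodule of genrep f by <:].

(* The tensor product of A and B over F: an element sum_k a_k (x) b_k is      *)
(* represented by the list of the pairs (a_k, b_k), and tensor_eq is equality *)
(* in the tensor product, i.e. the congruence on the commutative monoid of    *)
(* formal sums generated by the bilinearity relations.                        *)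

Inductive tensor_eq (F : fieldType) (A B : lmodType F) :
    seq (A * B) -> seq (A * B) -> Prop :=
  | tensor_perm t u : perm_eq t u -> tensor_eq t u
  | tensor_sym t u : tensor_eq t u -> tensor_eq u t
  | tensor_trans t u w : tensor_eq t u -> tensor_eq u w -> tensor_eq t w
  | tensor_cat t t' u u' :
      tensor_eq t t' -> tensor_eq u u' -> tensor_eq (t ++ u) (t' ++ u')
  | tensor_zero b : tensor_eq [:: (0, b)] [::]
  | tensor_addl a a' b : tensor_eq [:: (a + a', b)] [:: (a, b); (a', b)]
  | tensor_addr a b b' : tensor_eq [:: (a, b + b')] [:: (a, b); (a, b')]
  | tensor_scale c a b : tensor_eq [:: (c *: a, b)] [:: (a, c *: b)].

(* The multiplication map from R (x) (V (+) W), V and W being generated by f  *)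
(* and g.                                                                     *)
Definition mult_map (f g : poly3)
    (t : seq (sympoly3 * (genrep f * genrep g))) : poly3 :=
  \sum_(x <- t) (x.1 : poly3) * ((x.2.1 : poly3) + (x.2.2 : poly3)).

Definition mult_map_iso (m : rat) (f g : poly3) : Prop :=
  [/\ forall t, Qstd m (@mult_map f g t),
      forall p, Qstd m p -> exists t, @mult_map f g t = p &
      forall t u, @mult_map f g t = @mult_map f g u ->
        @tensor_eq 'F_2 sympoly3 (genrep f * genrep g)%type t u].

Definition freely_generated (m : rat) (f g : poly3) : Prop :=
  [/\ iso_std (in_genrep f), iso_std (in_genrep g) & mult_map_iso m f g].

Definition x1 : poly3 := 'X_(@Ordinal 3 0 isT).
Definition x2 : poly3 := 'X_(@Ordinal 3 1 isT).

(* Main.v *)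
Require Import Defs.
From HB Require Import structures.
From mathcomp Require Import all_boot all_order all_fingroup all_algebra.
From mathcomp Require Import ring.
From mathcomp Require Import mxrepresentation.
From mathcomp Require Import mpoly.

(** Write n = 2m+1 and q = 2^a, so that q < n <= 2q.

    Over F_2 the representation std is the sum-zero part of the permutation
    representation, hence a copy of std in the polynomial ring amounts to a
    family K_0, K_1, K_2 of polynomials which S_3 permutes like the indices and
    whose sum is zero ([std_family], [genrep_iso_std], [iso_std_family]).  The
    basic example is given by the linear forms l_k = x_i - x_j = x_i + x_j,
    where {i, j, k} = {0, 1, 2}, and by their 2^b-th powers, since raising to
    the power 2^b is additive.  Moreover K_i - s_ij K_i = K_i - K_j = K_k, so
    the family lies in Q_m exactly when l_k^n divides K_k for every k
    ([Q_family]).  Both proposed generators are members of such families: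
    A_k = l_k^(2q) and L_k = B_k delta^(n-q), where B_k = l_k^q and
    delta = l_0 l_1 l_2.

    Families are compared by means of the pairing
    <K, L> = sum_k K_k L_k, which is symmetric as a polynomial, and which in
    characteristic 2 equals the determinant K_i L_j - K_j L_i for any i != j.
    Cramer's rule reads <A, B> K = <K, B> A + <K, A> B, and <A, B> = delta^q.
    If l_k^n divides K_k for every k, then the determinant formula shows that
    delta^q divides <K, B> and that delta^n divides <K, A>; the second fact is
    where n <= 2q enters, the first one uses q <= n.  Dividing Cramer's rule by
    delta^q writes K as a combination of A and L with symmetric coefficients
    ([std_generated]).  Conversely, as <A, B> != 0, such a combination vanishes
    only if its coefficients do ([std_independent]).

    An identity between K and combinations of A and L is thus available index
    by index.  It remains to pass to the tensor product.  The space V (+) W has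
    the basis A_0, A_1, L_0, L_1, so every tensor can be brought to the form
    sum of r_i (x) b_i over these four vectors ([tensor_span]).  If the
    corresponding sum of products vanishes, it has the form P_0 + P'_1 = 0 for
    two families P and P', and the symmetries force P = P' = 0
    ([sum_family_eq0]); then independence applies. *)

Set Implicit Arguments.
Unset Strict Implicit.
Unset Printing Implicit Defensive.

Import GRing.Theory Num.Theory.
Local Open Scope ring_scope.

(** * Characteristic 2 *)

Lemma pchar2_poly3 : 2 \in [pchar poly3].
Proof.
by rewrite inE /= -(rmorph_nat (@mpolyC 3 'F_2)) pchar_Fp_0 // mpolyC0 eqxx.
Qed.

Lemma oppr2 (p : poly3) : - p = p.
Proof. exact: oppr_pchar2 pchar2_poly3 p. Qed.

Lemma addrr2 (p : poly3) : p + p = 0.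
Proof. exact: addrr_pchar2 pchar2_poly3 p. Qed.

Lemma exprD2 (p q : poly3) b : (p + q) ^+ (2 ^ b) = p ^+ (2 ^ b) + q ^+ (2 ^ b).
Proof.
apply: exprDn_pchar; apply: (@pnat_dvd _ (2 ^ b)%N) => //.
rewrite pnatX; apply/orP; left.
by rewrite pnatE // pchar2_poly3.
Qed.

(** * Triples of distinct indices *)

Lemma perm_enum3 (i j k : 'I_3) :
  uniq [:: i; j; k] -> perm_eq (index_enum 'I_3) [:: i; j; k].
Proof.
move=> ijk.
have sub : {subset [:: i; j; k] <= index_enum 'I_3}.
  by move=> x _; rewrite mem_index_enum.
rewrite perm_sym; apply: uniq_perm => //; first exact: index_enum_uniq.
have [|//] := uniq_min_size ijk sub.
by rewrite /index_enum -enumT size_enum_ord.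
Qed.

Lemma uniq3_rot (i j k : 'I_3) : uniq [:: i; j; k] = uniq [:: j; k; i].
Proof. by rewrite -(rot_uniq 1). Qed.

Lemma uniq3_swap (i j k : 'I_3) : uniq [:: i; j; k] = uniq [:: j; i; k].
Proof.
rewrite /= !inE !negb_or (eq_sym j i) -!andbA; congr (_ && _).
by rewrite andbCA.
Qed.

Lemma sum3 (V : nmodType) (K : 'I_3 -> V) i j k :
  uniq [:: i; j; k] -> \sum_x K x = K i + K j + K k.
Proof.
move=> ijk; rewrite (perm_big _ (perm_enum3 ijk)) /=.
by rewrite !big_cons big_nil addr0 addrA.
Qed.

Lemma prod3 (K : 'I_3 -> poly3) i j k :
  uniq [:: i; j; k] -> \prod_x K x = K i * K j * K k.
Proof.
move=> ijk; rewrite (perm_big _ (perm_enum3 ijk)) /=.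
by rewrite !big_cons big_nil mulr1 mulrA.
Qed.

Lemma third3 (i j : 'I_3) : i != j -> exists k, uniq [:: i; j; k].
Proof.
move=> ij; exists (inord (3 - i - j)).
have lt3 : (3 - i - j < 3)%N.
  by case: i ij => [[|[|[|i]]] hi]; case: j => [[|[|[|j]]] hj].
rewrite /= !inE -!val_eqE /= inordK //.
by case: i ij {lt3} => [[|[|[|i]]] hi]; case: j => [[|[|[|j]]] hj].
Qed.

Lemma others3 (k : 'I_3) : exists i j, uniq [:: i; j; k].
Proof.
have [j kj] : exists j, k != j.
  by exists (if k == ord0 then ord_max else ord0); case: k => [[|[|[|k]]] hk].
have [i kji] := third3 kj; exists i, j.
by rewrite uniq3_swap -uniq3_rot.
Qed.

(** * Divisibility by a difference of variables *)

Lemma dvd_0 d : mpoly_dvd d 0.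
Proof. by exists 0; rewrite mul0r. Qed.

Lemma dvd_D d p q : mpoly_dvd d p -> mpoly_dvd d q -> mpoly_dvd d (p + q).
Proof. by move=> [p' ->] [q' ->]; exists (p' + q'); rewrite mulrDl. Qed.

Lemma dvd_Ml d p q : mpoly_dvd d q -> mpoly_dvd d (p * q).
Proof. by move=> [q' ->]; exists (p * q'); rewrite mulrA. Qed.

Lemma dvd_Mr d p q : mpoly_dvd d p -> mpoly_dvd d (p * q).
Proof. by rewrite mulrC; apply: dvd_Ml. Qed.

Lemma dvd_X d m n : (m <= n)%N -> mpoly_dvd (d ^+ m) (d ^+ n).
Proof. by move=> mn; exists (d ^+ (n - m)); rewrite -exprD subnK. Qed.

Lemma dvd_trans d e p : mpoly_dvd d e -> mpoly_dvd e p -> mpoly_dvd d p.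
Proof. by move=> [e' ->] [p' ->]; exists (p' * e'); rewrite mulrA. Qed.

Definition collapse (i j : 'I_3) : 3.-tuple poly3 :=
  [tuple 'X_(if k == i then j else k) | k < 3].

(** The polynomials congruent to their image form a subring that contains the
    variables. *)
Lemma collapse_cong i j p :
  mpoly_dvd ('X_i - 'X_j) (p - (p \mPo collapse i j)).
Proof.
set d := 'X_i - 'X_j.
have congM x y x' y' : mpoly_dvd d (x - x') -> mpoly_dvd d (y - y') ->
    mpoly_dvd d (x * y - x' * y').
  move=> xx yy; have -> : x * y - x' * y' = (x - x') * y + x' * (y - y').
    by ring.
  by apply: dvd_D; [apply: dvd_Mr | apply: dvd_Ml].
have congX k e : mpoly_dvd d ('X_k ^+ e - ('X_k \mPo collapse i j) ^+ e).
  rewrite comp_mpolyXU -tnth_nth tnth_mktuple.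
  elim: e => [|e IHe]; first by rewrite subrr; apply: dvd_0.
  rewrite !exprS; apply: congM => //.
  case: eqP => [->|_]; first by exists 1; rewrite mul1r.
  by rewrite subrr; apply: dvd_0.
elim/mpolyind: p => [|c m p _ _ IHp].
  by rewrite comp_mpoly0 subrr; apply: dvd_0.
rewrite comp_mpolyD comp_mpolyZ opprD addrACA -scalerBr; apply: dvd_D => //.
rewrite -mul_mpolyC; apply: dvd_Ml.
rewrite mpolyXE_id rmorph_prod /=.
apply: (big_ind2 (fun x y => mpoly_dvd d (x - y))) => [|x x' y y' ? ?|k _].
- by rewrite subrr; apply: dvd_0.
- exact: congM.
- by rewrite rmorphXn; apply: congX.
Qed.

Lemma dvd_collapse i j p :
  mpoly_dvd ('X_i - 'X_j) p <-> p \mPo collapse i j = 0.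
Proof.
split=> [[q ->]|p0]; last first.
  by have := collapse_cong i j p; rewrite p0 subr0.
rewrite rmorphM rmorphB /= !comp_mpolyXU -!tnth_nth !tnth_mktuple eqxx.
by rewrite (fun_if (fun k => 'X_k)); case: eqP => [->|_]; rewrite subrr mulr0.
Qed.

(** By the criterion above, 'X_i - 'X_j generates the kernel of a substitution
    into a domain, so it is prime. *)
Lemma dvd_prime i j p q : mpoly_dvd ('X_i - 'X_j) (p * q) ->
  mpoly_dvd ('X_i - 'X_j) p \/ mpoly_dvd ('X_i - 'X_j) q.
Proof.
move=> /dvd_collapse; rewrite rmorphM => /eqP.
by rewrite mulf_eq0 => /orP[]/eqP; [left|right]; apply/dvd_collapse.
Qed.

(** * The three linear forms and their product *)

(** In characteristic 2 this is 'X_i - 'X_j for the two indices i, j other than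
    k; in the present form its equivariance under S_3 is visible. *)
Definition lf (k : 'I_3) : poly3 := \sum_x 'X_x - 'X_k.

Lemma lfE i j k : uniq [:: i; j; k] -> lf k = 'X_i - 'X_j.
Proof.
by move=> ijk; rewrite /lf (sum3 _ ijk) addrK (oppr2 'X_j).
Qed.

Lemma lf_neq0 k : lf k != 0.
Proof.
have [i [j ijk]] := others3 k; rewrite (lfE ijk) subr_eq0.
apply/eqP=> /(congr1 (meval (fun x => (x == i)%:R))); rewrite !mevalXU eqxx.
by move: ijk; rewrite /= inE (eq_sym i j); case: eqP => //=.
Qed.

(** Substituting one variable for the other in the first form sends the second
    form to the third one, which is nonzero. *)
Lemma lf_coprime k k' : k != k' -> ~ mpoly_dvd (lf k) (lf k').
Proof.
move=> /third3[i kk'i].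
have ik : uniq [:: i; k'; k] by rewrite -uniq3_rot uniq3_swap uniq3_rot.
have ki : uniq [:: k; i; k'] by rewrite uniq3_swap uniq3_rot.
rewrite (lfE ik) => /dvd_collapse; rewrite (lfE ki).
rewrite rmorphB /= !comp_mpolyXU -!tnth_nth !tnth_mktuple eqxx.
case: eqP ki => [->|_ _]; first by rewrite /= inE eqxx.
by apply/eqP; rewrite -(lfE kk'i) lf_neq0.
Qed.

Lemma lf_prime k p q : mpoly_dvd (lf k) (p * q) ->
  mpoly_dvd (lf k) p \/ mpoly_dvd (lf k) q.
Proof.
by have [i [j ijk]] := others3 k; rewrite (lfE ijk); apply: dvd_prime.
Qed.

Lemma lf_coprimeX k k' e : k != k' -> ~ mpoly_dvd (lf k) (lf k' ^+ e).
Proof.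
move=> kk'; elim: e => [|e IHe].
  by move=> /(dvd_Ml (lf k')); rewrite mulr1; apply: lf_coprime.
by rewrite exprS => /lf_prime[/(lf_coprime kk')|].
Qed.

(** One factor lf k is cancelled at a time: lf k is prime and does not divide
    lf k' ^+ e. *)
Lemma lf_dvd_mulX k k' n e p : k != k' ->
  mpoly_dvd (lf k ^+ n) (lf k' ^+ e * p) -> mpoly_dvd (lf k ^+ n) p.
Proof.
move=> kk'; elim: n p => [|n IHn] p; first by exists p; rewrite mulr1.
move=> dvd_n1; have [|q pE] := IHn p.
  by apply: dvd_trans dvd_n1; apply: dvd_X.
have : mpoly_dvd (lf k) (lf k' ^+ e * q).
  case: dvd_n1 => r; rewrite pE mulrA exprS mulrA => rE; exists r.
  by apply: mulIf rE; rewrite expf_neq0 ?lf_neq0.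
case/lf_prime=> [/(lf_coprimeX kk')//|[r qE]].
by exists r; rewrite pE qE exprS mulrA.
Qed.

Definition delta : poly3 := \prod_k lf k.

(** The powers of the three forms are split off one after the other; each
    divides the remaining cofactor, being coprime to those already removed. *)
Lemma dvd_deltaX n p : (forall k, mpoly_dvd (lf k ^+ n) p) ->
  mpoly_dvd (delta ^+ n) p.
Proof.
move=> dvd_p; pose i : 'I_3 := 0; pose j : 'I_3 := 1; pose k : 'I_3 := 1 + 1.
have [p1 pE] := dvd_p i.
have [|p2 p1E] := @lf_dvd_mulX j i n n p1 isT; first by rewrite mulrC -pE.
have [|p3 p2E] := @lf_dvd_mulX k i n n p2 isT.
  apply: (@lf_dvd_mulX k j n n) => //; have := dvd_p k.
  by rewrite pE p1E; congr mpoly_dvd; ring.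
have ijk : uniq [:: i; j; k] by [].
by exists p3; rewrite pE p1E p2E /delta (prod3 _ ijk) !exprMn; ring.
Qed.

(** * Families of polynomials carrying a copy of std *)

(** The images of e_j + e_k under an equivariant map from std to the polynomial
    ring, where {i, j, k} = {0, 1, 2}. *)
Definition std_family (K : 'I_3 -> poly3) : Prop :=
  (forall s i, msym s (K i) = K (s i)) /\ \sum_i K i = 0.

Lemma family_sub K i j k :
  std_family K -> uniq [:: i; j; k] -> K i - K j = K k.
Proof.
move=> [_ K0] ijk; apply/eqP; rewrite -subr_eq0 (oppr2 (K j)) (oppr2 (K k)).
by rewrite -(sum3 K ijk) K0.
Qed.

Lemma family_eq0 K i j : std_family K -> K i = 0 -> K j = 0.
Proof. by move=> [symK _] Ki0; rewrite -(tpermL i j) -symK Ki0 msym0. Qed.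

Lemma family_comb K L a b :
  std_family K -> std_family L -> a \is symmetric -> b \is symmetric ->
  std_family (fun k => a * K k + b * L k).
Proof.
move=> [symK K0] [symL L0] /issymP sa /issymP sb; split=> [s i|].
  by rewrite msymD !msymM sa sb symK symL.
by rewrite big_split /= -!mulr_sumr K0 L0 !mulr0 addr0.
Qed.

Lemma family_scale K a :
  std_family K -> a \is symmetric -> std_family (fun k => a * K k).
Proof.
move=> [symK K0] /issymP sa; split=> [s i|]; first by rewrite msymM sa symK.
by rewrite -mulr_sumr K0 mulr0.
Qed.

Lemma msym_lf s k : msym s (lf k) = lf (s k).
Proof.
have symX i : msym s 'X_i = 'X_(s i) by rewrite /msym mmapX mmap1U.
rewrite /lf msymB symX rmorph_sum /=; congr (_ - _).
rewrite [RHS](reindex_inj (@perm_inj _ s)).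
by apply: eq_bigr => i _; rewrite symX.
Qed.

Lemma lf_family b : std_family (fun k => lf k ^+ (2 ^ b)).
Proof.
split=> [s i|]; first by rewrite rmorphXn /= msym_lf.
have ijk : uniq [:: 0; 1; 1 + 1 : 'I_3] by [].
have -> : \sum_k lf k ^+ (2 ^ b) = (\sum_k lf k) ^+ (2 ^ b).
  by rewrite !(sum3 _ ijk) !exprD2.
suff -> : \sum_k lf k = 0 by rewrite expr0n expn_eq0.
by rewrite /lf sumrB sumr_const card_ord mulrSr addrK mulr2n addrr2.
Qed.

Lemma delta_sym : delta \is symmetric.
Proof.
apply/issymP=> s; rewrite /delta rmorph_prod /=.
rewrite [RHS](reindex_inj (@perm_inj _ s)).
by apply: eq_bigr => i _; rewrite msym_lf.
Qed.

Lemma delta_neq0 : delta != 0.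
Proof. by apply/prodf_neq0 => k _; apply: lf_neq0. Qed.

(** For i, j, k distinct, K_i - s_ij K_i = K_i - K_j = K_k, while
    K_k - s_ij K_k = 0. *)
Lemma Q_family m K : std_family K ->
  (forall k, Q m (K k)) <-> (forall k, mpoly_dvd (lf k ^+ qexp m) (K k)).
Proof.
move=> stdK; split=> [QK k|dvdK x i j ij].
  have [i [j]] := others3 k.
  wlog ij : i j / (i < j)%N.
    move=> ltP ijk; have [|ji|/val_inj ij] := ltngtP i j.
    - by move/ltP; apply.
    - by apply: (ltP _ _ ji); rewrite -uniq3_swap.
    - by move: ijk; rewrite ij /= inE eqxx.
  move=> ijk; have := QK i i j ij.
  by rewrite -(lfE ijk) stdK.1 tpermL (family_sub stdK ijk).
have [|k ijk] := @third3 i j; first by rewrite -val_eqE neq_ltn ij.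
rewrite -(lfE ijk) stdK.1; case: tpermP => [->|->|_ _].
- by rewrite (family_sub stdK ijk).
- by rewrite (family_sub stdK (k := k)) // -uniq3_swap.
- by rewrite subrr; apply: dvd_0.
Qed.

(** * The invariant pairing *)

Definition pairing (K L : 'I_3 -> poly3) : poly3 := \sum_x K x * L x.

Lemma pairing_sym K L :
  std_family K -> std_family L -> pairing K L \is symmetric.
Proof.
move=> [symK _] [symL _]; apply/issymP=> s; rewrite /pairing rmorph_sum /=.
rewrite [RHS](reindex_inj (@perm_inj _ s)).
by apply: eq_bigr => i _; rewrite msymM symK symL.
Qed.

(** Eliminating the third index by means of the sum-zero relations, the pairing
    differs from the determinant by an even polynomial. *)
Lemma pairingE K L i j : std_family K -> std_family L -> i != j ->
  pairing K L = K i * L j - K j * L i.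
Proof.
move=> stdK stdL /third3[k ijk].
rewrite /pairing (sum3 _ ijk) -(family_sub stdK ijk) -(family_sub stdL ijk).
rewrite -[RHS]addr0 -(addrr2 (K i * L i + K j * L j - K i * L j)); ring.
Qed.

(** Cramer's rule for the two coordinates k and i, where i is any index other
    than k. *)
Lemma pairing_cramer K A B k : std_family K -> std_family A -> std_family B ->
  pairing A B * K k = pairing K B * A k + pairing K A * B k.
Proof.
move=> stdK stdA stdB; have [i [j ijk]] := others3 k.
have ki : k != i.
  by move: ijk; rewrite -uniq3_rot /= inE negb_or => /andP[/andP[]].
(* With this change of sign the identity holds over the integers. *)
rewrite -[X in _ + X]oppr2.
rewrite !(pairingE _ _ ki) //; ring.
Qed.

(** Expanded along the index k, the pairing is a combination of K_k and of a
    power of lf k that is at least the e-th; and the lf k are pairwise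
    coprime. *)
Lemma pairing_lf_dvd K e b : std_family K -> (e <= 2 ^ b)%N ->
  (forall k, mpoly_dvd (lf k ^+ e) (K k)) ->
  mpoly_dvd (delta ^+ e) (pairing K (fun k => lf k ^+ (2 ^ b))).
Proof.
move=> stdK le_e dvdK; apply: dvd_deltaX => k.
have [i [j ijk]] := others3 k.
have ki : k != i.
  by move: ijk; rewrite -uniq3_rot /= inE negb_or => /andP[/andP[]].
rewrite (pairingE stdK (lf_family b) ki) oppr2.
by apply: dvd_D; [apply: dvd_Mr | apply/dvd_Ml/dvd_X].
Qed.

(** With u, v, w the 2^b-th powers of the three forms,
    u^2 v - v^2 u = u v (u - v) and u - v = w. *)
Lemma pairing_lf_lf b :
  pairing (fun k => lf k ^+ (2 ^ b.+1)) (fun k => lf k ^+ (2 ^ b))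
    = delta ^+ (2 ^ b).
Proof.
have ijk : uniq [:: 0; 1; 1 + 1 : 'I_3] by [].
rewrite (pairingE (lf_family b.+1) (lf_family b) (i := 0) (j := 1)) //.
rewrite /delta (prod3 _ ijk) !exprMn -(family_sub (lf_family b) ijk).
by rewrite expnS mulnC !exprM; ring.
Qed.

(** The coefficients are the quotients of the pairings with the two families of
    powers by delta ^+ (2 ^ b) and by delta ^+ n; Cramer's rule then gives the
    expansion after multiplication by delta ^+ (2 ^ b). *)
Lemma std_generated K n b : (2 ^ b <= n <= 2 ^ b.+1)%N -> std_family K ->
  (forall k, mpoly_dvd (lf k ^+ n) (K k)) ->
  exists al be, [/\ al \is symmetric, be \is symmetric & forall k,
    K k = al * lf k ^+ (2 ^ b.+1)
        + be * (lf k ^+ (2 ^ b) * delta ^+ (n - 2 ^ b))].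
Proof.
move=> /andP[le_n ge_n] stdK dvdK.
have dX_sym e : delta ^+ e \is symmetric by rewrite rpredX ?delta_sym.
have dX_neq0 e : delta ^+ e != 0 by rewrite expf_neq0 ?delta_neq0.
have [|al alE] := @pairing_lf_dvd K (2 ^ b) b stdK (leqnn _).
  by move=> k; apply: dvd_trans (dvdK k); apply: dvd_X.
have [be beE] := pairing_lf_dvd stdK ge_n dvdK.
exists al, be; split=> [||k].
- apply: (msymMK (dX_neq0 (2 ^ b)%N)) => //.
  by rewrite mulrC -alE pairing_sym //; apply: lf_family.
- apply: (msymMK (dX_neq0 n)) => //.
  by rewrite mulrC -beE pairing_sym //; apply: lf_family.
apply: (mulfI (dX_neq0 (2 ^ b)%N)); rewrite -pairing_lf_lf.
rewrite pairing_cramer //; try exact: lf_family.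
by rewrite alE beE pairing_lf_lf -{1}(subnK le_n) exprD; ring.
Qed.

Lemma det2_eq0 (a b x y z t : poly3) :
  a * x + b * y = 0 -> a * z + b * t = 0 -> a * (x * t - z * y) = 0.
Proof.
move=> xy zt.
have -> : a * (x * t - z * y) = (a * x + b * y) * t - (a * z + b * t) * y.
  by ring.
by rewrite xy zt !mul0r subr0.
Qed.

(** The coefficient al is annihilated by the determinant of the coordinates 0
    and 1 of the two families, a power of delta. *)
Lemma std_independent al be b c :
  (forall k, al * lf k ^+ (2 ^ b.+1)
             + be * (lf k ^+ (2 ^ b) * delta ^+ c) = 0) ->
  al = 0 /\ be = 0.
Proof.
move=> comb0.
have d_neq0 e : delta ^+ e != 0 by rewrite expf_neq0 ?delta_neq0.
have ij : 0 != 1 :> 'I_3 by [].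
have := det2_eq0 (comb0 0) (comb0 1); rewrite !mulrA -mulrBl.
rewrite -(pairingE (lf_family b.+1) (lf_family b) ij) pairing_lf_lf => /eqP.
rewrite !mulf_eq0 !(negPf (d_neq0 _)) !orbF => /eqP al0; split=> //.
have /eqP := comb0 0; rewrite al0 mul0r add0r !mulf_eq0 (negPf (d_neq0 _)).
by rewrite (negPf (expf_neq0 _ (lf_neq0 _))) !orbF => /eqP.
Qed.

(** * Copies of std and families *)

Lemma F2_case (x : 'F_2) : x = 0 \/ x = 1.
Proof. by case: x => [[|[|x]] hx] //; [left|right]; apply: val_inj. Qed.

Lemma F2_addrr (x : 'F_2) : x + x = 0.
Proof. by case: (F2_case x) => ->; apply: val_inj. Qed.

Lemma F2_oppr (x : 'F_2) : - x = x.
Proof. by case: (F2_case x) => ->; apply: val_inj. Qed.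

(** The equivariant map from the permutation representation that sends e_i to
    K i. *)
Definition perm_comb (K : 'I_3 -> poly3) (w : 'rV['F_2]_3) : poly3 :=
  \sum_i w 0 i *: K i.

Lemma perm_comb_is_linear K : linear (perm_comb K).
Proof.
move=> a v w; rewrite /perm_comb scaler_sumr -big_split /=.
by apply: eq_bigr => i _; rewrite !mxE scalerDl scalerA.
Qed.

HB.instance Definition _ K := GRing.isLinear.Build 'F_2 'rV['F_2]_3 poly3 _
  (perm_comb K) (perm_comb_is_linear K).

Lemma perm_comb_delta K i : perm_comb K (delta_mx 0 i) = K i.
Proof.
rewrite /perm_comb (bigD1 i) //= mxE !eqxx scale1r.
rewrite big1 ?addr0 // => j /negPf ji.
by rewrite mxE ji scale0r.
Qed.

Lemma msym_perm_comb K (s : 'S_3) w : std_family K ->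
  perm_comb K (w *m perm_mx s) = msym s (perm_comb K w).
Proof.
move=> [symK _]; rewrite /perm_comb rmorph_sum (reindex_inj (@perm_inj _ s)) /=.
apply: eq_bigr => i _; rewrite msymZ symK; congr (_ *: _).
by rewrite -[s in perm_mx s]invgK -col_permE mxE permK.
Qed.

Lemma sum0_mxP (w : 'rV['F_2]_3) :
  reflect (\sum_i w 0 i = 0) (w <= sum0_mx)%MS.
Proof.
have wE : (w *m const_mx 1 : 'cV_1) = (\sum_i w 0 i)%:M.
  apply/matrixP=> i j; rewrite !ord1 !mxE eqxx mulr1n.
  by apply: eq_bigr => k _; rewrite mxE mulr1.
apply: (iffP sub_kermxP) => [|w0]; last by rewrite wE w0 raddf0.
by rewrite wE => /matrixP/(_ 0 0); rewrite !mxE eqxx.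
Qed.

(** Over F_2, if two entries of a sum-zero vector w differ, then the relation
    with coefficients w makes one K i vanish, hence all of them; so w is
    constant, and its sum 0 is three times, that is once, this constant. *)
Lemma perm_comb_inj K k w : std_family K -> K k != 0 ->
  (w <= sum0_mx)%MS -> perm_comb K w = 0 -> w = 0.
Proof.
move=> stdK Kk0 /sum0_mxP; rewrite /perm_comb => w0 Kw0.
have Ki0 i : K i <> 0 by move/(family_eq0 k stdK)/eqP; rewrite (negPf Kk0).
have w_eq i j : w 0 i = w 0 j.
  have [->//|ij] := eqVneq i j; have [l ijl] := third3 ij.
  move: w0 Kw0; rewrite !(sum3 _ ijl) -(family_sub stdK ijl).
  move=> /eqP; rewrite addrC addr_eq0 F2_oppr => /eqP->.
  case: (F2_case (w 0 i)) (F2_case (w 0 j)) => -> [] -> //.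
    rewrite scale0r add0r add0r !scale1r addrC subrK.
    by move/Ki0.
  rewrite scale0r !addr0 !scale1r addrA addrr2 add0r.
  by move/eqP; rewrite oppr_eq0 => /eqP /Ki0.
apply/rowP=> i; rewrite mxE -[RHS]w0.
rewrite (eq_bigr (fun=> w 0 i)) => [|j _]; last exact: w_eq.
by rewrite sumr_const card_ord !mulrS mulr0n addr0 F2_addrr addr0.
Qed.

Lemma in_genrepP K k p : std_family K ->
  reflect (exists w, p = perm_comb K w) (in_genrep (K k) p).
Proof.
move=> stdK; apply: (iffP existsP) => [[c /eqP->]|[w ->]].
  exists (\row_i \sum_(s : 'S_3 | s k == i) c s); rewrite /perm_comb.
  rewrite (partition_big (fun s : 'S_3 => s k) xpredT) //=.
  apply: eq_bigr => i _; rewrite mxE scaler_suml; apply: eq_bigr => s /eqP <-.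
  by rewrite stdK.1.
suff : perm_comb K w \in in_genrep (K k) by move/existsP.
apply: rpred_sum => i _; apply: rpredZ; apply/existsP.
exists [ffun s => (s == tperm k i)%:R]; apply/eqP.
rewrite (bigD1 (tperm k i)) //= ffunE eqxx scale1r stdK.1 tpermL big1 ?addr0 //.
by move=> s /negPf ne; rewrite ffunE ne scale0r.
Qed.

(** The relation between the K i says that perm_comb kills the all-ones vector,
    which is not of sum zero; so perm_comb has the same image on sum-zero
    vectors as on all vectors, and it is injective there. *)
Lemma genrep_iso_std K k :
  std_family K -> K k != 0 -> iso_std (in_genrep (K k)).
Proof.
move=> stdK Kk0.
exists (perm_comb K \o (val_submod : 'rV_(\rank sum0_mx) -> _)); split=> /=.
- apply: raddf_inj => v /= /(perm_comb_inj stdK Kk0 (val_submodP _)) /eqP.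
  by rewrite val_submod_eq0 => /eqP.
- move=> s v; rewrite -msym_perm_comb //; congr perm_comb.
  by rewrite val_submodJ ?inE.
move=> p; split=> [/(in_genrepP k p stdK)[w ->]|[v <-]]; last first.
  by apply/(in_genrepP k _ stdK); exists (val_submod v).
(* Subtracting a multiple of the all-ones vector makes the sum zero. *)
exists (in_submod sum0_mx (w - (\sum_i w 0 i) *: const_mx 1)).
rewrite in_submodK.
  rewrite linearB linearZ_LR /= [perm_comb K (const_mx 1)](_ : _ = 0).
    by rewrite scaler0 subr0.
  by rewrite -[RHS]stdK.2; apply: eq_bigr => i _; rewrite mxE scale1r.
apply/sum0_mxP; under eq_bigr do rewrite !mxE mulr1.
by rewrite sumrB sumr_const card_ord !mulrS mulr0n addr0 F2_addrr addr0 subrr.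
Qed.

(** The family consists of the images of the vectors with entries 1 except for a
    0 in position i: for w of sum zero, the combination of these vectors with
    coefficients w is - w = w. *)
Lemma iso_std_family V : iso_std V -> exists K, std_family K /\
  forall p, p \in V <-> exists w, p = perm_comb K w.
Proof.
move=> [phi [phi_inj phiJ phiV]].
pose e i : 'rV['F_2]_3 := const_mx 1 - delta_mx 0 i.
have e_sum0 i : (e i <= sum0_mx)%MS.
  apply/sum0_mxP; under eq_bigr do rewrite !mxE eqxx /=.
  rewrite sumrB sumr_const card_ord (bigD1 i) //= eqxx big1 => [|j /negPf-> //].
  exact: val_inj.
pose K i := phi (in_submod sum0_mx (e i)).
exists K; split.
  split=> [s i|].
    rewrite /K -phiJ -in_submodJ //; congr (phi (in_submod _ _)).
    apply/rowP=> j; rewrite /= -[s in perm_mx s]invgK -col_permE !mxE eqxx /=.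
    by rewrite (can2_eq (permKV s) (permK s)).
  rewrite /K -!raddf_sum /= [\sum_i _](_ : _ = 0) ?raddf0 //.
  apply/rowP=> j; rewrite summxE; under eq_bigr do rewrite !mxE eqxx /=.
  rewrite sumrB sumr_const card_ord (bigD1 j) //= eqxx big1 => [|i].
    by rewrite mxE; apply: val_inj.
  by rewrite eq_sym => /negPf->.
move=> p; rewrite phiV; split=> [[v <-]|[w ->]].
  suff {1}-> : v = in_submod sum0_mx (\sum_i val_submod v 0 i *: e i).
    exists (val_submod v); rewrite /perm_comb !raddf_sum; apply: eq_bigr => i _.
    by rewrite /= !linearZ_LR.
  rewrite -[LHS]val_submodK; congr in_submod.
  have /sum0_mxP := val_submodP v; move: (val_submod v) => w w0.
  (* The combination of the e i equals (sum of w) *: 1 - w, and w has sum 0. *)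
  rewrite -[LHS]opprK (_ : \sum_i _ = - w).
    by apply/rowP=> j; rewrite !mxE F2_oppr.
  rewrite [w in RHS]row_sum_delta /e -sumrN.
  under eq_bigr do rewrite scalerBr.
  by rewrite sumrB -scaler_suml w0 scale0r add0r sumrN.
exists (\sum_i w 0 i *: in_submod sum0_mx (e i)).
by rewrite raddf_sum; apply: eq_bigr => i _; rewrite /= linearZ_LR.
Qed.

(** * Tensor products with a finitely spanned factor *)

Lemma tensor_refl (F : fieldType) (A B : lmodType F) (t : seq (A * B)) :
  tensor_eq t t.
Proof. exact: tensor_perm. Qed.

Lemma tensor_addl_seq (F : fieldType) (A B : lmodType F) (I : Type)
    (r : seq I) (al be : I -> A) (b : I -> B) :
  tensor_eq [seq (al i + be i, b i) | i <- r]
    ([seq (al i, b i) | i <- r] ++ [seq (be i, b i) | i <- r]).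
Proof.
elim: r => [|i r IHr] /=; first exact: tensor_refl.
apply: tensor_trans (tensor_cat (tensor_addl (al i) (be i) (b i)) IHr) _.
apply: tensor_perm => /=; rewrite perm_cons.
exact/permEl/(perm_catCA [:: _]).
Qed.

Lemma tensor_0r (F : fieldType) (A B : lmodType F) (a : A) :
  @tensor_eq F A B [:: (a, 0)] [::].
Proof.
apply: tensor_trans (tensor_zero A (0 : B)).
rewrite -{1}(scale0r (0 : B)) -(scale0r a).
exact/tensor_sym/tensor_scale.
Qed.

Lemma tensor_sumr (F : fieldType) (A B : lmodType F) (I : Type)
    (r : seq I) (a : A) (x : I -> B) :
  tensor_eq [:: (a, \sum_(i <- r) x i)] [seq (a, x i) | i <- r].
Proof.
elim: r => [|i r IHr]; first by rewrite big_nil; apply: tensor_0r.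
rewrite big_cons; apply: tensor_trans (tensor_addr _ _ _) _.
exact: tensor_cat (tensor_refl [:: (a, x i)]) IHr.
Qed.

(** Each elementary tensor is expanded along the vectors b i, the scalars are
    moved to the left factor, and the left factors of equal b i are added. *)
Lemma tensor_span (F : fieldType) (A B : lmodType F) (I : Type)
    (r : seq I) (b : I -> B) :
  (forall x, exists c : I -> F, x = \sum_(i <- r) c i *: b i) ->
  forall t : seq (A * B), exists al : I -> A,
    tensor_eq t [seq (al i, b i) | i <- r].
Proof.
move=> span; elim=> [|[a x] t [be tE]].
  exists (fun=> 0); elim: r {span} => [|i r IHr]; first exact: tensor_refl.
  exact: tensor_cat (tensor_sym (tensor_zero A (b i))) IHr.
have [c ->] := span x; exists (fun i => c i *: a + be i).
apply: tensor_trans (tensor_sym (tensor_addl_seq _ _ _ _)).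
apply: (@tensor_cat _ _ _ [:: _]) tE; apply: tensor_trans (tensor_sumr _ _ _) _.
elim: r {span} => [|i r IHr]; first exact: tensor_refl.
exact: tensor_cat (tensor_sym (tensor_scale _ _ _)) IHr.
Qed.

(** * Elements of Qstd *)

Lemma mult_map_tensor f g t u :
  tensor_eq t u -> @mult_map f g t = mult_map u.
Proof.
rewrite /mult_map.
elim=> {t u} [t u tu|//|t u w _ -> _ ->//|t t' u u' _ + _||||].
- exact: perm_big.
- by rewrite !big_cat /= => -> ->.
- by move=> b; rewrite big_seq1 big_nil mul0r.
- by move=> a a' b; rewrite !big_cons !big_nil !addr0 -mulrDl.
- move=> a [b c] [b' c']; rewrite !big_cons !big_nil !addr0 -mulrDr /=.
  by rewrite addrACA.
- move=> c a [b b']; rewrite !big_seq1 /= -scalerDr.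
  by rewrite -scalerAl -scalerAr.
Qed.

Lemma Q_perm_comb m K w : (forall k, Q m (K k)) -> Q m (perm_comb K w).
Proof.
move=> QK i j ij; rewrite /perm_comb rmorph_sum -sumrB /=.
apply: (big_ind (mpoly_dvd _)) => [|p q|k _]; first exact: dvd_0.
  exact: dvd_D.
by rewrite msymZ -scalerBr -mul_mpolyC; apply/dvd_Ml/QK.
Qed.

Lemma Qstd_0 m : Qstd m 0.
Proof. by exists [::]; rewrite big_nil. Qed.

Lemma Qstd_D m p q : Qstd m p -> Qstd m q -> Qstd m (p + q).
Proof.
move=> [ps [-> psP]] [qs [-> qsP]]; exists (ps ++ qs); rewrite big_cat.
by split=> // r; rewrite mem_cat => /orP[/psP|/qsP].
Qed.

Lemma Qstd_perm_comb m K w :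
  std_family K -> (forall k, Q m (K k)) -> Qstd m (perm_comb K w).
Proof.
move=> stdK QK; have [K0|K0] := eqVneq (K 0) 0.
  rewrite /perm_comb big1; first exact: Qstd_0.
  by move=> i _; rewrite (family_eq0 i stdK K0) scaler0.
exists [:: perm_comb K w]; rewrite big_seq1; split=> // p.
rewrite inE => /eqP->.
exists (in_genrep (K 0)); split; last by apply/(in_genrepP 0 _ stdK); exists w.
- split=> [|s q]; first exact: in_genrep_submod.
  move=> /(in_genrepP 0 _ stdK)[v ->]; rewrite -msym_perm_comb //.
  by apply/(in_genrepP 0 _ stdK); eexists.
- by move=> r /(in_genrepP 0 _ stdK)[v ->]; apply: Q_perm_comb.
- exact: genrep_iso_std.
Qed.

Lemma perm_comb_mul K a w : a * perm_comb K w = perm_comb (fun k => a * K k) w.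
Proof.
by rewrite /perm_comb mulr_sumr; apply: eq_bigr => i _; rewrite -scalerAr.
Qed.

Lemma Q_mul_sym m a K : std_family K -> (forall k, Q m (K k)) ->
  a \is symmetric -> forall k, Q m (a * K k).
Proof.
move=> stdK QK syma; apply/(Q_family m (family_scale stdK syma)) => k.
by apply: dvd_Ml; move: k; apply/Q_family.
Qed.

(** Multiplying a family by a symmetric polynomial gives a family that still
    lies in Q_m, so the product lies in a copy of std, unless it is zero. *)
Lemma Qstd_mul m K k (r : sympoly3) (v : genrep (K k)) : std_family K ->
  (forall k, Q m (K k)) -> Qstd m ((r : poly3) * (v : poly3)).
Proof.
move=> stdK QK; case: v => v /= /(in_genrepP k _ stdK)[w ->].
case: r => r /= symr; rewrite perm_comb_mul.
by apply: Qstd_perm_comb; [apply: family_scale | apply: Q_mul_sym].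
Qed.

(** As K 0 = L 1 up to sign, K 0 is fixed by the transposition (0 2) that fixes
    L 1; so K 0 = K 2, and K 1 = K 0 - K 2 = 0. *)
Lemma sum_family_eq0 K L : std_family K -> std_family L -> K 0 + L 1 = 0 ->
  forall k, K k = 0 /\ L k = 0.
Proof.
move=> stdK stdL KL k; have ijk : uniq [:: 0; 1 + 1; 1 : 'I_3] by [].
have K02 : K 0 = K (1 + 1).
  rewrite -[RHS](_ : msym (tperm 0 (1 + 1)) (K 0) = _); last first.
    by rewrite stdK.1 tpermL.
  move/eqP: KL; rewrite addr_eq0 => /eqP->.
  by rewrite msymN stdL.1 tpermD.
have K1 : K 1 = 0 by rewrite -(family_sub stdK ijk) K02 subrr.
have L1 : L 1 = 0 by move: KL; rewrite (family_eq0 0 stdK K1) add0r.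
by rewrite (family_eq0 k stdK K1) (family_eq0 k stdL L1).
Qed.

Lemma perm_comb_span K w : std_family K ->
  exists c0 c1, perm_comb K w = c0 *: K 0 + c1 *: K 1.
Proof.
move=> stdK; have ijk : uniq [:: 0; 1; 1 + 1 : 'I_3] by [].
exists (w 0 0 + w 0 (1 + 1)), (w 0 1 - w 0 (1 + 1)).
rewrite /perm_comb (sum3 _ ijk) -(family_sub stdK ijk).
rewrite scalerBr !scalerDl scaleNr.
by rewrite [RHS]addrACA.
Qed.

(** * Freeness from independence and generation *)

Lemma mem_genrep K i k : std_family K -> in_genrep (K k) (K i).
Proof.
move=> stdK; apply/in_genrepP => //; exists (delta_mx 0 i).
by rewrite perm_comb_delta.
Qed.

Definition family_elt K k (stdK : std_family K) i : genrep (K k) :=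
  GenRep (mem_genrep i k stdK).

Lemma family_elt_span K k (stdK : std_family K) (v : genrep (K k)) :
  exists c0 c1, v = c0 *: family_elt k stdK 0 + c1 *: family_elt k stdK 1.
Proof.
case: v => v vP; have [w vE] := in_genrepP k v stdK vP.
have [c0 [c1 wE]] := perm_comb_span w stdK.
by exists c0, c1; apply: val_inj; rewrite /= vE wE.
Qed.

(** The first component of the index chooses between the two summands, the
    second one between the indices 0 and 1, which suffice since the three
    members of a family have sum zero. *)
Definition std_basis K L k (stdK : std_family K) (stdL : std_family L)
    (i : bool * bool) : genrep (K k) * genrep (L k) :=
  let j := if i.2 then 1 else 0 in
  if i.1 then (0, family_elt k stdL j) else (family_elt k stdK j, 0).

Definition bool2_enum : seq (bool * bool) :=
  [:: (false, false); (false, true); (true, false); (true, true)].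

Lemma std_basis_span K L k (stdK : std_family K) (stdL : std_family L)
    (x : genrep (K k) * genrep (L k)) :
  exists c : bool * bool -> 'F_2,
    x = \sum_(i <- bool2_enum) c i *: std_basis k stdK stdL i.
Proof.
case: x => v w.
have [v0 [v1 ->]] := family_elt_span stdK v.
have [w0 [w1 ->]] := family_elt_span stdL w.
exists (fun i =>
  if i.1 then if i.2 then w1 else w0 else if i.2 then v1 else v0).
rewrite !big_cons big_nil /= addr0.
by congr pair => /=; rewrite !scaler0 ?addr0 ?add0r.
Qed.

(** Let d be the difference of the coefficients of the normal forms of t and u.
    Equality of the products says that the families
    d (false, x) K + d (true, x) L for x = false and x = true, taken at the
    indices 0 and 1 respectively, add up to zero; hence both families vanish,
    and independence gives d = 0. *)
Lemma mult_map_inj K L k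
    (t u : seq (sympoly3 * (genrep (K k) * genrep (L k)))) :
  std_family K -> std_family L ->
  (forall al be, (forall i, al * K i + be * L i = 0) -> al = 0 /\ be = 0) ->
  mult_map t = mult_map u -> tensor_eq t u.
Proof.
move=> stdK stdL indep.
have [al tE] := tensor_span (std_basis_span stdK stdL) t.
have [be uE] := tensor_span (std_basis_span stdK stdL) u.
rewrite (mult_map_tensor tE) (mult_map_tensor uE) => tu.
suff albe : forall i, i \in bool2_enum -> al i = be i.
  apply: tensor_trans tE (tensor_trans _ (tensor_sym uE)).
  rewrite (eq_in_map _ (fun i => (be i, std_basis k stdK stdL i)) _).1.
    exact: tensor_refl.
  by move=> i /albe->.
pose d i : poly3 := (al i : poly3) - (be i : poly3).
have d_sym i : d i \is symmetric.
  by rewrite rpredB //; [case: (al i) | case: (be i)].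
have P_std x : std_family (fun j => d (false, x) * K j + d (true, x) * L j).
  exact: family_comb.
have d0 x : d (false, x) = 0 /\ d (true, x) = 0.
  apply: indep => j.
  have [] := sum_family_eq0 (P_std false) (P_std true) _ j; last by case: x.
  move/eqP: tu; rewrite -subr_eq0 /mult_map !big_cons !big_nil /=.
  by rewrite !addr0 !add0r => /eqP <-; rewrite /d; ring.
move=> i _; apply: val_inj; apply/eqP; rewrite -subr_eq0; apply/eqP.
by move: i => [[] x]; have [] := d0 x.
Qed.

Lemma mult_map_Qstd m K L k
    (t : seq (sympoly3 * (genrep (K k) * genrep (L k)))) :
  std_family K -> std_family L ->
  (forall i, Q m (K i)) -> (forall i, Q m (L i)) -> Qstd m (mult_map t).
Proof.
move=> stdK stdL QK QL.
apply: (big_ind (Qstd m)) => [||[r [v w]] _ /=]; first exact: Qstd_0.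
  exact: Qstd_D.
by rewrite mulrDr; apply: Qstd_D; apply: Qstd_mul.
Qed.

(** In a copy of std inside Q_m, with family M = al K + be L, the element with
    coordinates w is al times that of K plus be times that of L. *)
Lemma mult_map_surj m K L k p : std_family K -> std_family L ->
  (forall M, std_family M -> (forall i, Q m (M i)) ->
    exists al be, [/\ al \is symmetric, be \is symmetric &
      forall i, M i = al * K i + be * L i]) ->
  Qstd m p -> exists t, @mult_map (K k) (L k) t = p.
Proof.
move=> stdK stdL gen [ps [-> psP]]; elim: ps psP => [|q ps IHps] psP.
  by exists [::]; rewrite /mult_map !big_nil.
have [|t tE] := IHps; first by move=> r rps; apply: psP; rewrite inE rps orbT.
have [V [_ QV /iso_std_family[M [stdM MV]] qV]] := psP q (mem_head _ _).
have [w qE] := (MV q).1 qV.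
have [|al [be [al_sym be_sym ME]]] := gen M stdM.
  by move=> i; apply/QV/MV; exists (delta_mx 0 i); rewrite perm_comb_delta.
have KP := introT (in_genrepP k _ stdK) (ex_intro _ w erefl).
have LP := introT (in_genrepP k _ stdL) (ex_intro _ w erefl).
exists [:: (SymPoly3 al_sym, (GenRep KP, 0)),
           (SymPoly3 be_sym, (0, GenRep LP)) & t].
rewrite /mult_map 2!big_cons -/(mult_map t) tE big_cons addrA /= addr0 add0r.
congr (_ + _); rewrite qE !perm_comb_mul /perm_comb -big_split /=.
by apply: eq_bigr => i _; rewrite ME scalerDr.
Qed.

Lemma std_family_free m K L k : std_family K -> std_family L ->
  K k != 0 -> L k != 0 ->
  (forall i, Q m (K i)) -> (forall i, Q m (L i)) ->
  (forall al be, (forall i, al * K i + be * L i = 0) -> al = 0 /\ be = 0) ->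
  (forall M, std_family M -> (forall i, Q m (M i)) ->
    exists al be, [/\ al \is symmetric, be \is symmetric &
      forall i, M i = al * K i + be * L i]) ->
  freely_generated m (K k) (L k).
Proof.
move=> stdK stdL K0 L0 QK QL indep gen; split; try exact: genrep_iso_std.
split=> [t|p|t u]; first exact: mult_map_Qstd.
  exact: mult_map_surj.
exact: mult_map_inj.
Qed.

(** * The two generators *)

Lemma qexp_half k : qexp (k%:R / 2) = k.+1.
Proof.
by rewrite /qexp mulrC divfK // natr1 natrK.
Qed.

Lemma dvd_lf_delta k n e : (e <= n)%N ->
  mpoly_dvd (lf k ^+ n) (lf k ^+ e * delta ^+ (n - e)).
Proof.
move=> le_n; have [i [j ijk]] := others3 k.
exists ((lf i * lf j) ^+ (n - e)).
rewrite -[in RHS](subnKC le_n) exprD addKn /delta (prod3 _ ijk) !exprMn; ring.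
Qed.

Lemma prod_diffX e :
  \prod_(i < 3) \prod_(j < 3 | (i < j)%N) ('X_i - 'X_j : poly3) ^+ e
    = delta ^+ e.
Proof.
pose i0 : 'I_3 := Ordinal (isT : 0 < 3)%N.
pose i1 : 'I_3 := Ordinal (isT : 1 < 3)%N.
pose i2 : 'I_3 := Ordinal (isT : 2 < 3)%N.
have ijk : uniq [:: i0; i1; i2] by [].
pose F (i j : 'I_3) : poly3 := ('X_i - 'X_j) ^+ e.
have FE i j k : uniq [:: i; j; k] -> F i j = lf k ^+ e.
  by move=> /lfE lfk; rewrite /F -lfk.
have prodE (i : 'I_3) : \prod_(j < 3 | (i < j)%N) F i j =
    (if (i < i0)%N then F i i0 else 1) * (if (i < i1)%N then F i i1 else 1)
    * (if (i < i2)%N then F i i2 else 1).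
  by rewrite big_mkcond (prod3 _ ijk).
rewrite (eq_bigr _ (fun i _ => prodE i)) (prod3 _ ijk) {prodE} [LHS]/=.
rewrite (FE i0 i1 i2 isT) (FE i0 i2 i1 isT) (FE i1 i2 i0 isT).
rewrite /delta (prod3 _ ijk); move: (lf i0) (lf i1) (lf i2) => p q r.
by rewrite !mul1r !mulr1 !exprMn; ring.
Qed.

Theorem theorem3p6 (m : rat) (a : nat)
    (half_m : exists k : nat, m = k%:R / 2)
    (lt_a : (2 ^ a)%:R < 2 * m + 1)
    (max_a : forall b : nat, (2 ^ b)%:R < 2 * m + 1 -> (b <= a)%N) :
  freely_generated m
    ((x1 - x2) ^+ (2 ^ a.+1))
    ((x1 - x2) ^+ (2 ^ a) *
       \prod_(i < 3) \prod_(j < 3 | (i < j)%N)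
         (('X_i - 'X_j : {mpoly 'F_2[3]}) ^+ (qexp m - 2 ^ a))).
Proof.
have [k mE] := half_m; pose n := qexp m.
have nE : 2 * m + 1 = n%:R.
  by rewrite /n mE qexp_half mulrC divfK // natr1.
have lt_n : (2 ^ a < n)%N by move: lt_a; rewrite nE ltr_nat.
have ge_n : (n <= 2 ^ a.+1)%N.
  rewrite leqNgt; apply/negP=> lt_n'.
  by have := max_a a.+1; rewrite nE ltr_nat ltnn => /(_ lt_n').
pose i0 : 'I_3 := Ordinal (isT : 0 < 3)%N.
pose i1 : 'I_3 := Ordinal (isT : 1 < 3)%N.
pose i2 : 'I_3 := Ordinal (isT : 2 < 3)%N.
have ijk : uniq [:: i0; i1; i2] by [].
have -> : x1 - x2 = lf i2 by rewrite (lfE ijk).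
rewrite prod_diffX -/n.
have d_sym : delta ^+ (n - 2 ^ a) \is symmetric by rewrite rpredX ?delta_sym.
pose K i := lf i ^+ (2 ^ a.+1).
pose L i := lf i ^+ (2 ^ a) * delta ^+ (n - 2 ^ a).
have stdK : std_family K by apply: lf_family.
have stdL : std_family L.
  have [symL L0] := family_scale (lf_family a) d_sym.
  split=> [s i|]; first by rewrite /L mulrC symL mulrC.
  by rewrite -[RHS]L0; apply: eq_bigr => i _; rewrite mulrC.
apply: (@std_family_free m K L) => //.
- exact/expf_neq0/lf_neq0.
- by rewrite mulf_neq0 ?expf_neq0 ?lf_neq0 ?delta_neq0.
- by apply/Q_family => // i; apply: dvd_X.
- by apply/Q_family => // i; apply/dvd_lf_delta/ltnW.
- by move=> al be; apply: std_independent.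
- move=> M stdM /(Q_family m stdM); apply: std_generated => //.
  by rewrite (ltnW lt_n).
Qed.
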